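(* In the setting described in the context, let $n\ge0$ and assume that $\mathsf U_i^n\in\mathcal A$ for all $i\in\mathcal V$. Then, under the time-step restriction $\tau\le\min_{i\in\mathcal V}\frac{m_i}{2|d_{ii}^{L,n}|}$, the convex-limited update $$\mathsf U_i^{n+1}=\mathsf U_i^{L,n+1}+\sum_{j\in\mathcal I^*(i)}\ell_{ij}^n\lambda_i\mathsf P_{ij}^n$$ with the limiting coefficients $\ell_{ij}^n=\min(\ell_j^{i,v},\ell_i^{j,v})$ is invariant-domain preserving, i.e. $\mathsf U_i^{n+1}\in\mathcal A$ for all $i\in\mathcal V$.
   Context: Setting: approximation of the shallow water equations (no external sources) in dimension $d\in\{1,2\}$ with forward Euler time stepping and convex limiting. States and flux. $\mathcal A=\{(h,q)^T\in\mathbb R^{d+1}: h>0\}$. Linear maps $\mathsf H:\mathbb R^{d+1}\to\mathbb R$ and $\mathsf Q:\mathbb R^{d+1}\to\mathbb R^d$ extract depth and discharge of a state $(h,q)^T$. $g>0$ is the gravity constant. The flux is $\mathbb f(u)=(q,\ q\otimes v+\frac12 g h^2 I_d)^T$ with $v=q/h$, so for $c\in\mathbb R^d$: $\mathbb f(u)c=(q\cdot c,\ (v\cdot c)q+\frac12 gh^2c)^T$ (zero if $h=0$, $q=0$). $E_{\rm flat}(u)=\frac12gh^2+\frac12h\|v\|^2$, $F_{\rm flat}(u)=v(E_{\rm flat}(u)+\frac12gh^2)$. Discretization. $\mathcal V=\{1,\dots,I\}$ indexes the degrees of freedom; for each $i\in\mathcal V$, $\mathcal I(i)\subsetneq\mathcal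 V$ is the stencil at $i$ (containing $i$), and $\mathcal I^*(i)=\mathcal I(i)\setminus\{i\}$. Given are: masses $m_i>0$; an invertible symmetric matrix $(m_{ij})$ with $m_i=\sum_{j\in\mathcal I(i)}m_{ij}$; vectors $c_{ij}\in\mathbb R^d$ with $\sum_{j\in\mathcal I(i)}c_{ij}=0$ and $c_{ij}=-c_{ji}$ whenever $i$ or $j$ is not a boundary degree of freedom; $c_{ij}=0$ and $m_{ij}=0$ if $j\notin\mathcal I(i)$. The topography is given by real numbers $\mathsf Z_i$. The state at time $t^n$ is $\mathsf U_i^n=(\mathsf H_i^n,\mathsf Q_i^n)^T\in\mathbb R^{d+1}$; $\tau>0$ is the time step. Velocity. With a small parameter $\epsilon>0$ and a depth scale $h_{\max}>0$, the regularized velocity of a state $\mathsf U$ is $\mathsf V(\mathsf U)=\frac{2\mathsf H(\mathsf U)}{\mathsf H(\mathsf U)^2+\max(\mathsf H(\mathsf U),\epsilon h_{\max})^2}\mathsf Q(\mathsf U)$, and $\mathsf V_i^n=\mathsf V(\mathsf U_i^n)$. Hydrostatic reconstruction. $\mathsf H_i^{*,j}=\max(0,\mathsf H_i^n+\mathsf Z_i-\max(\mathsf Z_i,\mathsf Z_j))$, $\mathsf U_i^{*,j}=(\mathsf H_i^{*,j},\mathsf H_i^{*,j}\mathsf V_i^n)^T$. Low-order graph viscosity. For $j\in\mathcal I^*(i)$, $d_{ij}^{L,n}=\max\big(\lambda_{\max}(\mathsf U_i^{*,j},\mathsf U_j^{*,i},n_{ij})\|c_{ij}\|_{\ell^2},\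 \lambda_{\max}(\mathsf U_j^{*,i},\mathsf U_i^{*,j},n_{ji})\|c_{ji}\|_{\ell^2}\big)$, where $n_{ij}=c_{ij}/\|c_{ij}\|_{\ell^2}$ and $\lambda_{\max}(\mathsf U_\ell,\mathsf U_r,n)$ is a guaranteed upper bound on the maximum wave speed in the one-dimensional Riemann problem with left state $\mathsf U_\ell$, right state $\mathsf U_r$ and flux $\mathbb f(\cdot)n$. Also $d_{ii}^{L,n}=-\sum_{j\in\mathcal I^*(i)}d_{ij}^{L,n}$. Low-order update. $\frac{m_i}{\tau}(\mathsf U_i^{L,n+1}-\mathsf U_i^n)=\sum_{j\in\mathcal I(i)}\mathsf F_{ij}^{L,n}$ with $$\mathsf F_{ij}^{L,n}=-\big(\mathsf U_j^{*,i}\otimes\mathsf V_j^n+\mathsf U_i^{*,j}\otimes\mathsf V_i^n\big)c_{ij}+d_{ij}^{L,n}(\mathsf U_j^{*,i}-\mathsf U_i^{*,j})-\begin{pmatrix}0\\ g\,c_{ij}\big(\tfrac12(\mathsf H_j^{*,i})^2-\tfrac12(\mathsf H_i^{*,j})^2+(\mathsf H_i^n)^2\big)\end{pmatrix}.$$ High-order flux. $$\mathsf F_{ij}^{H,n}=-\big(\mathsf U_j^n\otimes\mathsf V_j^n+\mathsf U_i^n\otimes\mathsf V_i^n\big)c_{ij}+d_{ij}^{H,n}(\mathsf U_j^{*,i}-\mathsf U_i^{*,j})-\begin{pmatrix}0\\ g\big(\mathsf H_i^n\mathsf H_j^n+\mathsf H_i^n(\mathsf Z_j-\mathsf Z_i)\big)c_{ij}\end{pmatrix},\qquad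 \mathsf F_i^{H,n}=\sum_{j\in\mathcal I(i)}\mathsf F_{ij}^{H,n},$$ with $d_{ij}^{H,n}=d_{ij}^{L,n}\frac{\alpha_i^n+\alpha_j^n}{2}$ for $i\ne j$ (the value for $i=j$ multiplies zero), where $\alpha_i^n=\frac{|N_i^n|}{D_i^n+\epsilon D_{\max}}\in[0,1]$, $D_{\max}=\sqrt{gh_{\max}}\,\frac12gh_{\max}^2$, $N_i^n=\sum_{j\in\mathcal I(i)}\{F_{\rm flat}(\mathsf U_j^n)\cdot c_{ij}-\nabla_uE_{\rm flat}(\mathsf U_i^n)^T\mathbb f(\mathsf U_j^n)c_{ij}\}$, $D_i^n=|\sum_{j\in\mathcal I(i)}F_{\rm flat}(\mathsf U_j^n)\cdot c_{ij}|+|\sum_{j\in\mathcal I(i)}\nabla_uE_{\rm flat}(\mathsf U_i^n)^T\mathbb f(\mathsf U_j^n)c_{ij}|$. Corrections. $\lambda_i=1/\mathrm{Card}(\mathcal I^*(i))$, $b_{ij}=\delta_{ij}-m_{ij}/m_j$, $\mathsf P_{ij}^n=\frac{\tau}{m_i\lambda_i}\{\mathsf F_{ij}^{H,n}-\mathsf F_{ij}^{L,n}+b_{ij}\mathsf F_j^{H,n}-b_{ji}\mathsf F_i^{H,n}\}$; write $\mathsf P_{ij}^n=(\mathsf P_{ij}^h,\mathsf P_{ij}^q)^T$. Auxiliary states and local bounds. For $j\in\mathcal I^*(i)$, $\overline{\mathsf U}_{ij}^n=\frac12(\mathsf U_i^{*,j}+\mathsf U_j^{*,i})-\frac{1}{2d_{ij}^{L,n}}\big(\mathbb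 f(\mathsf U_j^{*,i})-\mathbb f(\mathsf U_i^{*,j})\big)c_{ij}$, and $\overline{\mathsf U}_{ii}^n=\mathsf U_i^n$. $\mathsf B_i^{L,n}=\sum_{j\in\mathcal I(i)}-2(d_{ij}^{L,n}+\mathsf V_i^n\cdot c_{ij})(\mathsf U_i^{*,j}-\mathsf U_i^n)$. $\overline{\mathsf W}_{ij}^n=\overline{\mathsf U}_{ij}^n+\frac{\tau}{m_i}\mathsf B_i^{L,n}$; $\mathsf H_{i,\min}^n$, $\mathsf H_{i,\max}^n$ are the min and max of $\mathsf H(\overline{\mathsf W}_{ij}^n)$ over $j\in\mathcal I(i)$; $\mathsf V_{i,\max}^{2,n}=\max_{j\in\mathcal I(i)}\|\mathsf V(\overline{\mathsf W}_{ij}^n)\|_{\ell^2}^2$. Limiter. With $\mathsf H_i^{L}=\mathsf H(\mathsf U_i^{L,n+1})$: $\ell_j^{i,h}=\min\big(\frac{|\mathsf H_{i,\min}^n-\mathsf H_i^L|}{|\mathsf P_{ij}^h|+\epsilon\mathsf H_{i,\max}^n},1\big)$ if $\mathsf H_i^L+\mathsf P_{ij}^h<\mathsf H_{i,\min}^n$; $\ell_j^{i,h}=1$ if $\mathsf H_{i,\min}^n\le\mathsf H_i^L+\mathsf P_{ij}^h\le\mathsf H_{i,\max}^n$; $\ell_j^{i,h}=\min\big(\frac{|\mathsf H_{i,\max}^n-\mathsf H_i^L|}{|\mathsf P_{ij}^h|+\epsilon\mathsf H_{i,\max}^n},1\big)$ if $\mathsf H_{i,\max}^n<\mathsf H_i^L+\mathsf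 P_{ij}^h$. Let $\Psi_3(\mathsf U)=\mathsf H(\mathsf U)^2\mathsf V_{i,\max}^{2,n}-\|\mathsf Q(\mathsf U)\|_{\ell^2}^2$. Then $\ell_j^{i,v}\in[0,\ell_j^{i,h}]$ is the largest number such that $\Psi_3(\mathsf U_i^{L,n+1}+\ell\,\mathsf P_{ij}^n)\ge0$ for all $\ell\in[0,\ell_j^{i,v}]$ (taken to be $0$ if there is none). Finally $\ell_{ij}^n=\min(\ell_j^{i,v},\ell_i^{j,v})$.
   Formalization: The claim fails if a dry reconstructed state carries no velocity; here the maximum wave speed bound uses the data (H_i^{*,j}, V_i^n), a dry state keeping velocity V_i^n, with wave speeds the limits of the wet ones as the depth tends to 0. Wet states are unaffected. *)

(* Defs.v *)
(* MathComp + MathComp-Analysis. *)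
From HB Require Import structures.
From mathcomp Require Import all_boot all_order all_algebra.
From mathcomp Require Import all_classical all_reals.
From mathcomp Require Import topology normedtype derive.
Set Implicit Arguments.
Unset Strict Implicit.
Unset Printing Implicit Defensive.
Import Order.TTheory GRing.Theory Num.Theory.
Import numFieldNormedType.Exports.
Local Open Scope classical_set_scope.
Local Open Scope ring_scope.

Definition dot (R : realType) (d : nat) (v w : 'rV[R]_d) : R :=
  \sum_k v 0 k * w 0 k.

(* The library norm of a matrix is the sup norm. *)
Definition norm2 (R : realType) (d : nat) (v : 'rV[R]_d) : R :=
  Num.sqrt (dot v v).

(* (h, q) stands for the column (h, q)^T of R^(d+1); the linear maps H and Q
   are the two projections. *)
Notation state R d := (R * 'rV[R]_d)%type.

Definition admissible (R : realType) (d : nat) : set (state R d) :=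
  [set u | 0 < u.1].

(* q / h, equal to 0 when h = 0. *)
Definition vel (R : realType) (d : nat) (u : state R d) : 'rV[R]_d :=
  u.1^-1 *: u.2.

(* The product f(u) c. *)
Definition flux (R : realType) (d : nat) (g : R) (u : state R d) (c : 'rV[R]_d) :
    state R d :=
  (dot u.2 c, dot (vel u) c *: u.2 + (2^-1 * g * u.1 ^+ 2) *: c).

Definition Eflat (R : realType) (d : nat) (g : R) (u : state R d) : R :=
  2^-1 * g * u.1 ^+ 2 + 2^-1 * u.1 * norm2 (vel u) ^+ 2.

Definition Fflat (R : realType) (d : nat) (g : R) (u : state R d) : 'rV[R]_d :=
  (Eflat g u + 2^-1 * g * u.1 ^+ 2) *: vel u.

Definition grad (R : realType) (d : nat) (E : state R d -> R^o) (u : state R d) :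
    state R d :=
  ('D_((1, 0) : state R d) E u,
   \row_k 'D_((0, delta_mx 0 k) : state R d) E u).

Definition sdot (R : realType) (d : nat) (u w : state R d) : R :=
  u.1 * w.1 + dot u.2 w.2.

(** Exact Riemann problem for the shallow water equations *)

(* [wave1 g h u hs us s]: the state of depth hs and velocity us is connected
   to the left state (h, u) by a 1-wave whose leftmost speed is s.  The wave is
   a rarefaction if hs <= h (constant Riemann invariant u + 2 sqrt (g h)), and
   otherwise a shock (Rankine-Hugoniot and Lax conditions).  As usual for
   maximum wave speed formulas, a 1-wave of zero strength has speed
   u - sqrt (g h). *)
Definition wave1 (R : realType) (g h u hs us s : R) : Prop :=
  [/\ hs <= h,
      us + 2 * Num.sqrt (g * hs) = u + 2 * Num.sqrt (g * h)
    & s = u - Num.sqrt (g * h)]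
  \/
  [/\ h < hs,
      s * (hs - h) = hs * us - h * u,
      s * (hs * us - h * u) =
        (hs * us ^+ 2 + 2^-1 * g * hs ^+ 2) - (h * u ^+ 2 + 2^-1 * g * h ^+ 2),
      s < u - Num.sqrt (g * h)
    & us - Num.sqrt (g * hs) < s].

(* 2-waves are the images of 1-waves under the reflection x |-> -x. *)
Definition wave2 (R : realType) (g h u hs us s : R) : Prop :=
  wave1 g h (- u) hs (- us) (- s).

(* [riemann_speeds g wl wr n sl sr]: sl and sr are the leftmost and rightmost
   wave speeds in the solution of the one-dimensional Riemann problem with flux
   f(.)n.  For d = 2 the tangential velocity is carried by a contact of speed
   us, which lies between sl and sr.

   The data are given in primitive variables: (h, v) stands for (h, h v).  On
   wet states this is only a change of variables, but a dry state keeps a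
   velocity.  The speeds attached to one dry state are the limits of those of
   the wet problem as its depth tends to 0 at fixed velocity; for a dry left
   state the leftmost speed is thus min (u_l, u_r - 2 a_r), not u_r - 2 a_r.
   This matters for a dry reconstructed state (0, 0) of a cell whose velocity is
   V_i: the low-order depth needs d_ij + V_i . c_ij >= 0, which no bound that
   ignores V_i can give, and the scheme does produce negative depths at boundary
   degrees of freedom otherwise.  Two dry states produce no wave. *)
Variant riemann_speeds (R : realType) (d : nat) (g : R) (wl wr : state R d)
    (n : 'rV[R]_d) : R -> R -> Prop :=
| RiemannWet (hs us sl sr : R) of
    0 < wl.1 & 0 < wr.1 & 0 < hs
    & wave1 g wl.1 (dot wl.2 n) hs us sl
    & wave2 g wr.1 (dot wr.2 n) hs us sr :
    riemann_speeds g wl wr n sl sr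
| RiemannVacuum of
    0 < wl.1 \/ 0 < wr.1
    & dot wl.2 n + 2 * Num.sqrt (g * wl.1)
        <= dot wr.2 n - 2 * Num.sqrt (g * wr.1) :
    riemann_speeds g wl wr n
      (dot wl.2 n - Num.sqrt (g * wl.1)) (dot wr.2 n + Num.sqrt (g * wr.1))
| RiemannDryLeft of
    wl.1 = 0 & 0 < wr.1
    & dot wr.2 n - 2 * Num.sqrt (g * wr.1) < dot wl.2 n :
    riemann_speeds g wl wr n
      (dot wr.2 n - 2 * Num.sqrt (g * wr.1)) (dot wr.2 n + Num.sqrt (g * wr.1))
| RiemannDryRight of
    0 < wl.1 & wr.1 = 0
    & dot wr.2 n < dot wl.2 n + 2 * Num.sqrt (g * wl.1) :
    riemann_speeds g wl wr n
      (dot wl.2 n - Num.sqrt (g * wl.1)) (dot wl.2 n + 2 * Num.sqrt (g * wl.1)).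

Definition wave_speed_bound (R : realType) (d : nat) (g : R)
    (lam : state R d -> state R d -> 'rV[R]_d -> R) : Prop :=
  forall (wl wr : state R d) (n : 'rV[R]_d) (sl sr : R),
    0 <= wl.1 -> 0 <= wr.1 -> norm2 n = 1 ->
    riemann_speeds g wl wr n sl sr ->
    Num.max `|sl| `|sr| <= lam wl wr n.

(** Data of the scheme *)

(* [lambda_max] takes primitive variables, as [riemann_speeds] does; the
   degrees of freedom are 0, ..., N - 1. *)
Record scheme (R : realType) (d N : nat) := Scheme {
  grav : R;
  eps : R;
  hmax : R;
  stencil : 'I_N -> {set 'I_N};
  boundary : {set 'I_N};
  mass : 'I_N -> R;
  cmass : 'M[R]_N;
  cvec : 'I_N -> 'I_N -> 'rV[R]_d;
  topo : 'I_N -> R;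
  lambda_max : state R d -> state R d -> 'rV[R]_d -> R
}.

Record scheme_axioms (R : realType) (d N : nat) (S : scheme R d N) : Prop := {
  grav_gt0 : 0 < grav S;
  eps_gt0 : 0 < eps S;
  hmax_gt0 : 0 < hmax S;
  stencil_self : forall i, i \in stencil S i;
  stencil_proper : forall i, stencil S i \proper finset.setT;
  mass_gt0 : forall i, 0 < mass S i;
  cmass_unit : cmass S \in unitmx;
  cmass_sym : (cmass S)^T = cmass S;
  mass_sum : forall i, mass S i = \sum_(j in stencil S i) cmass S i j;
  cvec_sum : forall i, \sum_(j in stencil S i) cvec S i j = 0;
  cvec_skew : forall i j, i \notin boundary S \/ j \notin boundary S ->
    cvec S i j = - cvec S j i;
  cvec_stencil : forall i j, j \notin stencil S i -> cvec S i j = 0;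
  cmass_stencil : forall i j, j \notin stencil S i -> cmass S i j = 0;
  lambda_max_bound : wave_speed_bound (grav S) (lambda_max S)
}.

(** One step of the scheme: U is the family of states at time t^n and tau the
    time step *)

Definition stencil' (R : realType) (d N : nat) (S : scheme R d N) (i : 'I_N) :
    {set 'I_N} :=
  stencil S i :\ i.

Definition regvel (R : realType) (d N : nat) (S : scheme R d N) (u : state R d) :
    'rV[R]_d :=
  (2 * u.1 / (u.1 ^+ 2 + Num.max u.1 (eps S * hmax S) ^+ 2)) *: u.2.

Definition Hstar (R : realType) (d N : nat) (S : scheme R d N)
    (U : 'I_N -> state R d) (i j : 'I_N) : R :=
  Num.max 0 ((U i).1 + topo S i - Num.max (topo S i) (topo S j)).

Definition Ustar (R : realType) (d N : nat) (S : scheme R d N)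
    (U : 'I_N -> state R d) (i j : 'I_N) : state R d :=
  (Hstar S U i j, Hstar S U i j *: regvel S (U i)).

(* Ustar in primitive variables. *)
Definition Wstar (R : realType) (d N : nat) (S : scheme R d N)
    (U : 'I_N -> state R d) (i j : 'I_N) : state R d :=
  (Hstar S U i j, regvel S (U i)).

Definition normal (R : realType) (d N : nat) (S : scheme R d N) (i j : 'I_N) :
    'rV[R]_d :=
  (norm2 (cvec S i j))^-1 *: cvec S i j.

Definition dL_off (R : realType) (d N : nat) (S : scheme R d N)
    (U : 'I_N -> state R d) (i j : 'I_N) : R :=
  Num.max
    (lambda_max S (Wstar S U i j) (Wstar S U j i) (normal S i j)
       * norm2 (cvec S i j))
    (lambda_max S (Wstar S U j i) (Wstar S U i j) (normal S j i)
       * norm2 (cvec S j i)).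

Definition dL (R : realType) (d N : nat) (S : scheme R d N)
    (U : 'I_N -> state R d) (i j : 'I_N) : R :=
  if j == i then - \sum_(k in stencil' S i) dL_off S U i k else dL_off S U i j.

(* (U (x) V) c = (V . c) U. *)
Definition FL (R : realType) (d N : nat) (S : scheme R d N)
    (U : 'I_N -> state R d) (i j : 'I_N) : state R d :=
  - (dot (regvel S (U j)) (cvec S i j) *: Ustar S U j i
     + dot (regvel S (U i)) (cvec S i j) *: Ustar S U i j)
  + dL S U i j *: (Ustar S U j i - Ustar S U i j)
  - (0, (grav S * (2^-1 * Hstar S U j i ^+ 2 - 2^-1 * Hstar S U i j ^+ 2
                   + (U i).1 ^+ 2)) *: cvec S i j).

Definition UL (R : realType) (d N : nat) (S : scheme R d N) (tau : R)
    (U : 'I_N -> state R d) (i : 'I_N) : state R d :=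
  U i + (tau / mass S i) *: \sum_(j in stencil S i) FL S U i j.

Definition entropy_num (R : realType) (d N : nat) (S : scheme R d N)
    (U : 'I_N -> state R d) (i : 'I_N) : R :=
  \sum_(j in stencil S i)
    (dot (Fflat (grav S) (U j)) (cvec S i j)
     - sdot (grad (Eflat (grav S)) (U i)) (flux (grav S) (U j) (cvec S i j))).

Definition entropy_den (R : realType) (d N : nat) (S : scheme R d N)
    (U : 'I_N -> state R d) (i : 'I_N) : R :=
  `|\sum_(j in stencil S i) dot (Fflat (grav S) (U j)) (cvec S i j)|
  + `|\sum_(j in stencil S i)
        sdot (grad (Eflat (grav S)) (U i)) (flux (grav S) (U j) (cvec S i j))|.

Definition Dmax (R : realType) (d N : nat) (S : scheme R d N) : R :=
  Num.sqrt (grav S * hmax S) * (2^-1 * grav S * hmax S ^+ 2).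

Definition alpha (R : realType) (d N : nat) (S : scheme R d N)
    (U : 'I_N -> state R d) (i : 'I_N) : R :=
  `|entropy_num S U i| / (entropy_den S U i + eps S * Dmax S).

(* The value at j = i is irrelevant: in FH it multiplies 0. *)
Definition dH (R : realType) (d N : nat) (S : scheme R d N)
    (U : 'I_N -> state R d) (i j : 'I_N) : R :=
  dL S U i j * ((alpha S U i + alpha S U j) / 2).

Definition FH (R : realType) (d N : nat) (S : scheme R d N)
    (U : 'I_N -> state R d) (i j : 'I_N) : state R d :=
  - (dot (regvel S (U j)) (cvec S i j) *: U j
     + dot (regvel S (U i)) (cvec S i j) *: U i)
  + dH S U i j *: (Ustar S U j i - Ustar S U i j)
  - (0, (grav S * ((U i).1 * (U j).1 + (U i).1 * (topo S j - topo S i)))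
          *: cvec S i j).

Definition FHsum (R : realType) (d N : nat) (S : scheme R d N)
    (U : 'I_N -> state R d) (i : 'I_N) : state R d :=
  \sum_(j in stencil S i) FH S U i j.

Definition lambda (R : realType) (d N : nat) (S : scheme R d N) (i : 'I_N) : R :=
  1 / #|stencil' S i|%:R.

Definition bcoef (R : realType) (d N : nat) (S : scheme R d N) (i j : 'I_N) : R :=
  (i == j)%:R - cmass S i j / mass S j.

Definition Pcorr (R : realType) (d N : nat) (S : scheme R d N) (tau : R)
    (U : 'I_N -> state R d) (i j : 'I_N) : state R d :=
  (tau / (mass S i * lambda S i)) *:
    (FH S U i j - FL S U i j
     + bcoef S i j *: FHsum S U j - bcoef S j i *: FHsum S U i).

Definition Ubar (R : realType) (d N : nat) (S : scheme R d N)
    (U : 'I_N -> state R d) (i j : 'I_N) : state R d :=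
  if j == i then U i else
    2^-1 *: (Ustar S U i j + Ustar S U j i)
    - (1 / (2 * dL S U i j)) *:
        (flux (grav S) (Ustar S U j i) (cvec S i j)
         - flux (grav S) (Ustar S U i j) (cvec S i j)).

Definition BL (R : realType) (d N : nat) (S : scheme R d N)
    (U : 'I_N -> state R d) (i : 'I_N) : state R d :=
  \sum_(j in stencil S i)
    (- 2 * (dL S U i j + dot (regvel S (U i)) (cvec S i j)))
      *: (Ustar S U i j - U i).

Definition Wbar (R : realType) (d N : nat) (S : scheme R d N) (tau : R)
    (U : 'I_N -> state R d) (i j : 'I_N) : state R d :=
  Ubar S U i j + (tau / mass S i) *: BL S U i.

(* Since i belongs to its stencil, the default values of the iterated min and
   max below are attained values. *)
Definition Hlocmin (R : realType) (d N : nat) (S : scheme R d N) (tau : R)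
    (U : 'I_N -> state R d) (i : 'I_N) : R :=
  \big[Num.min/(Wbar S tau U i i).1]_(j in stencil S i) (Wbar S tau U i j).1.

Definition Hlocmax (R : realType) (d N : nat) (S : scheme R d N) (tau : R)
    (U : 'I_N -> state R d) (i : 'I_N) : R :=
  \big[Num.max/(Wbar S tau U i i).1]_(j in stencil S i) (Wbar S tau U i j).1.

Definition V2locmax (R : realType) (d N : nat) (S : scheme R d N) (tau : R)
    (U : 'I_N -> state R d) (i : 'I_N) : R :=
  \big[Num.max/norm2 (regvel S (Wbar S tau U i i)) ^+ 2]_(j in stencil S i)
     norm2 (regvel S (Wbar S tau U i j)) ^+ 2.

(* limh S tau U i j is l_j^{i,h}, and similarly for limv below. *)
Definition limh (R : realType) (d N : nat) (S : scheme R d N) (tau : R)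
    (U : 'I_N -> state R d) (i j : 'I_N) : R :=
  let HL := (UL S tau U i).1 in
  let Ph := (Pcorr S tau U i j).1 in
  let Hmin := Hlocmin S tau U i in
  let Hmax := Hlocmax S tau U i in
  if HL + Ph < Hmin then
    Num.min (`|Hmin - HL| / (`|Ph| + eps S * Hmax)) 1
  else if HL + Ph <= Hmax then 1
  else Num.min (`|Hmax - HL| / (`|Ph| + eps S * Hmax)) 1.

Definition Psi3 (R : realType) (d N : nat) (S : scheme R d N) (tau : R)
    (U : 'I_N -> state R d) (i : 'I_N) (u : state R d) : R :=
  u.1 ^+ 2 * V2locmax S tau U i - norm2 u.2 ^+ 2.

Definition limv_set (R : realType) (d N : nat) (S : scheme R d N) (tau : R)
    (U : 'I_N -> state R d) (i j : 'I_N) : set R :=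
  [set l | 0 <= l <= limh S tau U i j /\
     forall l', 0 <= l' <= l ->
       0 <= Psi3 S tau U i (UL S tau U i + l' *: Pcorr S tau U i j)].

(* The largest element of limv_set, or 0 if there is none. *)
Definition limv (R : realType) (d N : nat) (S : scheme R d N) (tau : R)
    (U : 'I_N -> state R d) (i j : 'I_N) : R :=
  xget 0 [set l | limv_set S tau U i j l /\
                  forall l', limv_set S tau U i j l' -> l' <= l].

Definition limcoef (R : realType) (d N : nat) (S : scheme R d N) (tau : R)
    (U : 'I_N -> state R d) (i j : 'I_N) : R :=
  Num.min (limv S tau U i j) (limv S tau U j i).

Definition limited_update (R : realType) (d N : nat) (S : scheme R d N) (tau : R)
    (U : 'I_N -> state R d) (i : 'I_N) : state R d :=
  UL S tau U i
  + \sum_(j in stencil' S i) (limcoef S tau U i j * lambda S i) *: Pcorr S tau U i j.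

(* Main.v *)
Require Import Defs.
From HB Require Import structures.
From mathcomp Require Import all_boot all_order all_algebra.
From mathcomp Require Import all_classical all_reals.
From mathcomp Require Import topology normedtype realfun.
From mathcomp Require Import ring lra.
Set Implicit Arguments.
Unset Strict Implicit.
Unset Printing Implicit Defensive.
Import Order.TTheory GRing.Theory Num.Theory.
Import numFieldNormedType.Exports.
Local Open Scope classical_set_scope.
Local Open Scope ring_scope.

(** Only the depth component matters, and it is controlled in three stages.

    Wave speeds dominate velocities.  In any Riemann problem with at least one
    wet side, the leftmost speed is at most the left normal velocity and the
    rightmost speed is at least the right one, strictly on a wet side
    ([riemann_speeds_velocity]).  Since [wave_speed_bound] only says something
    about data for which a Riemann solution exists, that solution has to be
    constructed: away from vacuum the middle depth is a zero of a continuous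
    function, found by the intermediate value theorem
    ([riemann_speeds_exists]).  As the two reconstructed states of an edge are
    never dry together, the graph viscosity d_ij satisfies d_ij + V_i.c_ij >= 0
    and d_ij - V_j.c_ij >= 0 ([dL_off_bounds]).

    The local bounds are positive and hold for the low-order update.  The depth
    of the bar state is
      (H_i^* (d_ij + V_i.c_ij) + H_j^* (d_ij - V_j.c_ij)) / (2 d_ij) > 0
    if d_ij > 0, and the mean of H_i^* and H_j^* otherwise.
    The source B_i has a nonnegative depth because H_i^* <= H_i, so every
    depth of the states W_ij is positive ([Wbar_depth_gt0]).  Because the
    vectors c_ij sum to zero over j, the low-order depth is a combination of the
    depths of the W_ij with weights 2 tau d_ij / m_i and 1 minus their sum
    ([UL_depth_convex]); the time-step restriction makes it a convex
    combination ([UL_depth_bounds]).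

    The limiter keeps the depth positive.  If i has neighbours, the final
    update is the average of U_i^L + l_ij P_ij over them, since lambda_i is the
    inverse of their number; otherwise it is U_i^L.  Each l_ij is either 0 or
    lies in [0, l_j^{i,h}], and for such a coefficient the depth of
    U_i^L + l_ij P_ij is positive ([depth_limiter_gt0]). *)

(** * The exact Riemann problem *)

(** The velocity lost across a 1-wave joining depth [h] to depth [x]: the first
    term is the rarefaction branch (it vanishes for [x >= h]), the second the
    shock branch (it vanishes for [x <= h]).  Writing the branches with min and
    max instead of a case distinction makes continuity at [h] automatic. *)
Definition wave_drop (R : realType) (g h x : R) : R :=
  2 * (Num.sqrt (g * Num.min x h) - Num.sqrt (g * h))
  + (Num.max x h - h) * Num.sqrt (2^-1 * g * (h^-1 + (Num.max x h)^-1)).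

Lemma wave_drop_continuous (R : realType) (g h : R) :
  0 < h -> continuous (wave_drop g h).
Proof.
move=> h0 x.
have ccst (c : R) : {for x, continuous (fun=> c : R)} by exact: cst_continuous.
have cid : {for x, continuous (fun y : R => y)} by exact: cvg_id.
have csqrt (f : R -> R) : {for x, continuous f} ->
    {for x, continuous (fun y => Num.sqrt (f y))}.
  by move=> cf; apply: continuous_comp => //; exact: sqrt_continuous.
have cmin : {for x, continuous (fun y : R => Num.min y h)}.
  exact: (continuous_min cid (ccst h)).
have cmax : {for x, continuous (fun y : R => Num.max y h)}.
  exact: (continuous_max cid (ccst h)).
have max0 : Num.max x h != 0 by rewrite gt_eqF// lt_max h0 orbT.
have cinv : {for x, continuous (fun y : R => (Num.max y h)^-1)}.
  exact: (@continuousV R R (fun y : R => Num.max y h) x max0 cmax).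
have cadd (f k : R -> R) : {for x, continuous f} -> {for x, continuous k} ->
    {for x, continuous (fun y => f y + k y)}.
  by move=> cf ck; exact: (@continuousD R R^o R f k x cf ck).
have cmul (f k : R -> R) : {for x, continuous f} -> {for x, continuous k} ->
    {for x, continuous (fun y => f y * k y)}.
  by move=> cf ck; exact: (@continuousM R R f k x cf ck).
apply: (cadd (fun y => 2 * (Num.sqrt (g * Num.min y h) - Num.sqrt (g * h)))
  (fun y => (Num.max y h - h)
     * Num.sqrt (2^-1 * g * (h^-1 + (Num.max y h)^-1)))).
  apply: (cmul (fun=> 2) _ (ccst _)); apply: (cadd _ (fun=> _) _ (ccst _)).
  by apply: csqrt; exact: (cmul (fun=> g) _ (ccst _) cmin).
apply: (cmul (fun y => Num.max y h - h)).
  exact: (cadd _ (fun=> - h) cmax (ccst _)).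
apply: csqrt; apply: (cmul (fun=> 2^-1 * g) _ (ccst _)).
exact: (cadd (fun=> h^-1) _ (ccst _) cinv).
Qed.

(** Every positive middle depth lies on the 1-wave curve.  For [hs > h] the
    Rankine-Hugoniot conditions force the shock speed [u - hs * r], where [r] is
    the square root in [wave_drop], and both Lax inequalities reduce after
    squaring to [h < hs]. *)
Lemma wave1_wave_drop (R : realType) (g h u hs : R) :
  0 < g -> 0 < h -> 0 < hs -> exists s, wave1 g h u hs (u - wave_drop g h hs) s.
Proof.
move=> g0 h0 hs0; rewrite /wave_drop.
have [hsh|hhs] := leP hs h.
  exists (u - Num.sqrt (g * h)); left; split=> //; ring.
set r := Num.sqrt (2^-1 * g * _).
have r2 : r ^+ 2 = 2^-1 * g * (h^-1 + hs^-1).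
  by rewrite sqr_sqrtr ?mulr_ge0 ?addr_ge0 ?invr_ge0 ?ltW.
have r0 : 0 <= r by exact: sqrtr_ge0.
have hr2 : h * hs * r ^+ 2 = 2^-1 * g * (h + hs).
  by rewrite r2; field; rewrite !gt_eqF.
exists (u - hs * r); right; split=> //.
- ring.
- apply: (mulfI (lt0r_neq0 h0)).
  have -> : 2^-1 * g * h ^+ 2 = g * (h + hs) * h / 2 - h * hs * g / 2 by field.
  have -> : hs * (u - (2 * (Num.sqrt (g * h) - Num.sqrt (g * h)) + (hs - h) * r)) ^+ 2 + 2^-1 * g * hs ^+ 2 - (h * u ^+ 2 + (g * (h + hs) * h / 2 - h * hs * g / 2)) =
    hs * (u - (hs - h) * r) ^+ 2 - h * u ^+ 2 + (hs - h) * (2^-1 * g * (h + hs)) by field.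
  rewrite -hr2; ring.
- rewrite ltrD2l ltrN2.
  rewrite -(ltr_pXn2r (n := 2)) ?nnegrE ?mulr_ge0 ?sqrtr_ge0// ?(ltW hs0)//.
  rewrite sqr_sqrtr ?mulr_ge0 ?ltW// exprMn -(ltr_pM2l h0).
  have -> : h * (hs ^+ 2 * r ^+ 2) = hs * (2^-1 * g * (h + hs)) by rewrite -hr2; ring.
  rewrite -subr_gt0.
  have -> : hs * (2^-1 * g * (h + hs)) - h * (g * h)
    = 2^-1 * g * ((hs - h) * (2 * h + hs)) by field.
  by rewrite !mulr_gt0 ?subr_gt0 ?addr_gt0 ?mulr_gt0 ?invr_gt0.
- suff : h * r < Num.sqrt (g * hs) by lra.
  rewrite -(ltr_pXn2r (n := 2)) ?nnegrE ?mulr_ge0 ?sqrtr_ge0// ?(ltW h0)//.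
  rewrite sqr_sqrtr ?mulr_ge0 ?ltW// exprMn -(ltr_pM2l hs0).
  have -> : hs * (h ^+ 2 * r ^+ 2) = h * (2^-1 * g * (h + hs)) by rewrite -hr2; ring.
  rewrite -subr_gt0.
  have -> : hs * (g * hs) - h * (2^-1 * g * (h + hs))
    = 2^-1 * g * ((hs - h) * (2 * hs + h)) by field.
  by rewrite !mulr_gt0 ?subr_gt0 ?addr_gt0 ?mulr_gt0 ?invr_gt0.
Qed.

(** For a shock, Lax gives [s < u], and mass conservation across the front then
    forces the middle velocity to be on the same side of [s]. *)
Lemma wave1_speed (R : realType) (g h u hs us s : R) :
  0 < g -> 0 < h -> 0 < hs -> wave1 g h u hs us s -> s < u /\ s < us.
Proof.
move=> g0 h0 hs0.
have a0 : 0 < Num.sqrt (g * h) by rewrite sqrtr_gt0 mulr_gt0.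
case=> [[hsh inv ->]|[hhs mass _ lax _]].
  have : Num.sqrt (g * hs) <= Num.sqrt (g * h) by rewrite ler_wsqrtr// ler_pM2l.
  by lra.
have su : s < u by lra.
split=> //.
have e : hs * (us - s) = h * (u - s) by lra.
by rewrite -subr_gt0 -(pmulr_rgt0 _ hs0) e mulr_gt0// subr_gt0.
Qed.

(** The curves of the two waves meet where the sum of the two velocity drops is
    [ul - ur].  This sum is too small at depth 0, which is exactly the
    non-vacuum condition, and it is large enough at some depth because a shock
    loses velocity at least linearly in the depth. *)
Lemma wet_riemann_exists (R : realType) (g hl ul hr ur : R) :
  0 < g -> 0 < hl -> 0 < hr ->
  ur - 2 * Num.sqrt (g * hr) < ul + 2 * Num.sqrt (g * hl) ->
  exists hs us sl sr,
    [/\ 0 < hs, wave1 g hl ul hs us sl & wave2 g hr ur hs us sr].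
Proof.
move=> g0 hl0 hr0 novac.
pose F x := wave_drop g hl x + wave_drop g hr x.
pose k := Num.sqrt (2^-1 * g * hl^-1).
have k0 : 0 < k by rewrite sqrtr_gt0 !mulr_gt0 ?invr_gt0.
(* Beyond hl, the left drop grows with slope at least k. *)
pose M := Num.max hl hr + Num.max 0 (ul - ur) / k.
have Mm : Num.max hl hr <= M.
  by rewrite lerDl divr_ge0 ?le_max ?lexx// ltW.
have Ml : hl <= M by apply: le_trans Mm; rewrite le_max lexx.
have Mr : hr <= M by apply: le_trans Mm; rewrite le_max lexx orbT.
have M0 : 0 < M by exact: lt_le_trans Ml.
have F0 : F 0 < ul - ur.
  rewrite /F /wave_drop !(min_l (ltW _))// !(max_r (ltW _))// !subrr !mul0r.
  by rewrite mulr0 sqrtr0; lra.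
have FM : ul - ur <= F M.
  rewrite /F /wave_drop !min_r// !max_l// !subrr mulr0 !add0r.
  have le1 : ul - ur <= (M - hl) * k.
    have : hl <= Num.max hl hr by rewrite le_max lexx.
    rewrite -(ler_pdivrMr _ _ k0) /M => hm.
    have : (ul - ur) / k <= Num.max 0 (ul - ur) / k.
      by rewrite ler_pM2r ?invr_gt0// le_max lexx orbT.
    lra.
  have le2 : (M - hl) * k <= (M - hl) * Num.sqrt (2^-1 * g * (hl^-1 + M^-1)).
    rewrite ler_wpM2l ?subr_ge0// ler_wsqrtr// ler_pM2l ?mulr_gt0// ?invr_gt0//.
    by rewrite lerDl invr_ge0 ltW.
  have : 0 <= (M - hr) * Num.sqrt (2^-1 * g * (hr^-1 + M^-1)).
    by rewrite mulr_ge0 ?sqrtr_ge0// subr_ge0.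
  lra.
have [x xM Fx] : exists2 x, x \in `[0, M] & F x = ul - ur.
  apply: IVT; first exact: ltW.
    apply: continuous_subspaceT => x.
    by apply: cvgD; exact: wave_drop_continuous.
  by rewrite ge_min (ltW F0) le_max FM orbT.
have x0 : 0 < x.
  move: xM; rewrite in_itv/= lt_neqAle => /andP[-> _]; rewrite andbT.
  by apply/eqP => x0; move: F0; rewrite x0 Fx ltxx.
have [sl hsl] := wave1_wave_drop ul g0 hl0 x0.
have [sr hsr] := wave1_wave_drop (- ur) g0 hr0 x0.
exists x, (ul - wave_drop g hl x), sl, (- sr); split=> //.
rewrite /wave2 opprK.
suff -> : - (ul - wave_drop g hl x) = - ur - wave_drop g hr x by [].
by move: Fx; rewrite /F; lra.
Qed.

(** Guarantees that a [wave_speed_bound] is not vacuous: with one wet side some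
    case of [riemann_speeds] applies. *)
Lemma riemann_speeds_exists (R : realType) (d : nat) (g : R)
    (wl wr : state R d) (n : 'rV[R]_d) :
  0 < g -> 0 <= wl.1 -> 0 <= wr.1 -> 0 < wl.1 \/ 0 < wr.1 ->
  exists sl sr, riemann_speeds g wl wr n sl sr.
Proof.
move=> g0 l0 r0 wet.
have [vac|novac] := leP (dot wl.2 n + 2 * Num.sqrt (g * wl.1))
                        (dot wr.2 n - 2 * Num.sqrt (g * wr.1)).
  by exists (dot wl.2 n - Num.sqrt (g * wl.1)), (dot wr.2 n + Num.sqrt (g * wr.1));
    exact: RiemannVacuum.
move: l0 r0; rewrite !le_eqVlt => /orP[/eqP l0|l0] /orP[/eqP r0|r0].
- by case: wet; rewrite -?l0 -?r0 ltxx.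
- exists (dot wr.2 n - 2 * Num.sqrt (g * wr.1)), (dot wr.2 n + Num.sqrt (g * wr.1)).
  apply: RiemannDryLeft => //.
  by move: novac; rewrite -l0 mulr0 sqrtr0 mulr0 addr0.
- exists (dot wl.2 n - Num.sqrt (g * wl.1)),
         (dot wl.2 n + 2 * Num.sqrt (g * wl.1)).
  apply: RiemannDryRight => //.
  by move: novac; rewrite -r0 mulr0 sqrtr0 mulr0 subr0.
- have [hs [us [sl [sr [hs0 wv1 wv2]]]]] := wet_riemann_exists g0 l0 r0 novac.
  by exists sl, sr; exact: (RiemannWet l0 r0 hs0 wv1 wv2).
Qed.

Lemma riemann_speeds_velocity (R : realType) (d : nat) (g : R)
    (wl wr : state R d) (n : 'rV[R]_d) (sl sr : R) :
  0 < g -> 0 <= wl.1 -> 0 <= wr.1 -> riemann_speeds g wl wr n sl sr ->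
  [/\ sl <= dot wl.2 n, 0 < wl.1 -> sl < dot wl.2 n,
      dot wr.2 n <= sr, 0 < wr.1 -> dot wr.2 n < sr & sl < sr].
Proof.
move=> g0 l0 r0.
have agt (h : R) : 0 < h -> 0 < Num.sqrt (g * h).
  by move=> h0; rewrite sqrtr_gt0 mulr_gt0.
have al0 := sqrtr_ge0 (g * wl.1); have ar0 := sqrtr_ge0 (g * wr.1).
case=> [hs us {}sl {}sr {}l0 {}r0 hs0 wv1 wv2|wet vac|dl {}r0 novac|{}l0 dr novac].
- have [lu lus] := wave1_speed g0 l0 hs0 wv1.
  have [ru rus] := wave1_speed g0 r0 hs0 wv2.
  by split=> [|_||_|]; lra.
- split=> [|/agt||/agt|]; try lra.
  by case: wet => /agt; lra.
- by have := agt _ r0; split=> [|_|||]; lra.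
- by have := agt _ l0; split=> [|_|||]; lra.
Qed.

(** * Dot product and Euclidean norm *)

Lemma dotZl (R : realType) (d : nat) (a : R) (v w : 'rV[R]_d) :
  dot (a *: v) w = a * dot v w.
Proof. by rewrite /dot mulr_sumr; apply: eq_bigr => k _; rewrite mxE mulrA. Qed.

Lemma dotZr (R : realType) (d : nat) (a : R) (v w : 'rV[R]_d) :
  dot v (a *: w) = a * dot v w.
Proof. by rewrite /dot mulr_sumr; apply: eq_bigr => k _; rewrite mxE mulrCA. Qed.

Lemma dotv0 (R : realType) (d : nat) (v : 'rV[R]_d) : dot v 0 = 0.
Proof. by rewrite /dot big1// => k _; rewrite mxE mulr0. Qed.

Lemma dot_sumr (R : realType) (d : nat) (I : Type) (r : seq I) (P : pred I)
    (v : 'rV[R]_d) (F : I -> 'rV[R]_d) :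
  dot v (\sum_(i <- r | P i) F i) = \sum_(i <- r | P i) dot v (F i).
Proof.
rewrite /dot exchange_big/=; apply: eq_bigr => k _.
by rewrite summxE mulr_sumr.
Qed.

Lemma norm2_gt0 (R : realType) (d : nat) (v : 'rV[R]_d) : v != 0 -> 0 < norm2 v.
Proof.
move=> v0; have sq k : 0 <= v 0 k * v 0 k by rewrite -expr2 sqr_ge0.
rewrite sqrtr_gt0 lt_neqAle sumr_ge0 ?andbT//; apply: contraNN v0 => /eqP/esym.
move=> /psumr_eq0P v0; apply/eqP/rowP => k; rewrite mxE.
have /eqP := v0 (fun k _ => sq k) k isT.
by rewrite mulf_eq0 orbb => /eqP.
Qed.

Lemma norm2_normalized (R : realType) (d : nat) (v : 'rV[R]_d) :
  v != 0 -> norm2 ((norm2 v)^-1 *: v) = 1.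
Proof.
move=> /norm2_gt0 v0; have vv : dot v v = norm2 v ^+ 2.
  rewrite sqr_sqrtr//; apply/ltW; move: v0; by rewrite sqrtr_gt0.
rewrite {1}/norm2 dotZl dotZr vv -[RHS]sqrtr1; congr Num.sqrt.
by field; rewrite gt_eqF.
Qed.

(** * The graph viscosity dominates the velocities *)

(** Here -sl and sr are at most the wave speed bound, while -sl is at least minus
    the left velocity and sr at least the right one.  Positivity of [D] comes from
    sl < sr, since the bound is at least both -sl and sr. *)
Lemma viscosity_bound (R : realType) (d : nat) (g : R)
    (lam : state R d -> state R d -> 'rV[R]_d -> R)
    (wl wr : state R d) (c : 'rV[R]_d) (D : R) :
  0 < g -> wave_speed_bound g lam ->
  0 <= wl.1 -> 0 <= wr.1 -> 0 < wl.1 \/ 0 < wr.1 -> c != 0 ->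
  lam wl wr ((norm2 c)^-1 *: c) * norm2 c <= D ->
  [/\ 0 < D,
      0 <= D + dot wl.2 c, 0 < wl.1 -> 0 < D + dot wl.2 c,
      0 <= D - dot wr.2 c & 0 < wr.1 -> 0 < D - dot wr.2 c].
Proof.
move=> g0 hlam l0 r0 wet c0 hD.
set n := (norm2 c)^-1 *: c in hD.
have N0 : 0 < norm2 c by exact: norm2_gt0.
have [sl [sr speeds]] := riemann_speeds_exists n g0 l0 r0 wet.
have := hlam wl wr n sl sr l0 r0 (norm2_normalized c0) speeds.
rewrite ge_max => /andP[hsl hsr].
have [ll lls rr rrs slr] := riemann_speeds_velocity g0 l0 r0 speeds.
have hl : - sl <= lam wl wr n by rewrite (le_trans _ hsl)// -normrN ler_norm.
have hr : sr <= lam wl wr n by rewrite (le_trans _ hsr)// ler_norm.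
have dotn w : dot w c = norm2 c * dot w n.
  by rewrite dotZr mulrA divff ?mul1r// gt_eqF.
rewrite !dotn; split.
- by apply: lt_le_trans hD; rewrite pmulr_lgt0//; lra.
- apply: (@le_trans _ _ (norm2 c * (lam wl wr n + dot wl.2 n))); last lra.
  by rewrite pmulr_rge0//; lra.
- move=> /lls ?.
  apply: (@lt_le_trans _ _ (norm2 c * (lam wl wr n + dot wl.2 n))); last lra.
  by rewrite pmulr_rgt0//; lra.
- apply: (@le_trans _ _ (norm2 c * (lam wl wr n - dot wr.2 n))); last lra.
  by rewrite pmulr_rge0//; lra.
- move=> /rrs ?.
  apply: (@lt_le_trans _ _ (norm2 c * (lam wl wr n - dot wr.2 n))); last lra.
  by rewrite pmulr_rgt0//; lra.
Qed.

Lemma Hstar_ge0 (R : realType) (d N : nat) (S : scheme R d N)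
    (U : 'I_N -> state R d) (i j : 'I_N) : 0 <= Hstar S U i j.
Proof. by rewrite le_max lexx. Qed.

Lemma Hstar_le (R : realType) (d N : nat) (S : scheme R d N)
    (U : 'I_N -> state R d) (i j : 'I_N) :
  admissible (U i) -> Hstar S U i j <= (U i).1.
Proof.
move=> h0; rewrite ge_max (ltW h0) -addrA gerDl subr_le0.
by rewrite le_max lexx.
Qed.

Lemma Hstar_diag (R : realType) (d N : nat) (S : scheme R d N)
    (U : 'I_N -> state R d) (i : 'I_N) :
  admissible (U i) -> Hstar S U i i = (U i).1.
Proof. by move=> h0; rewrite /Hstar maxxx addrK max_r// ltW. Qed.

(** The side of the edge with the higher bottom keeps its full depth. *)
Lemma Hstar_wet (R : realType) (d N : nat) (S : scheme R d N)
    (U : 'I_N -> state R d) (i j : 'I_N) :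
  admissible (U i) -> admissible (U j) -> 0 < Hstar S U i j \/ 0 < Hstar S U j i.
Proof.
rewrite /admissible/= /Hstar !lt_max !ltxx/= => hi hj.
by have [ij|ji] := leP (topo S i) (topo S j); [right|left]; rewrite addrK.
Qed.

(** When c_ij vanishes, the viscosity of the edge may still be positive (through
    c_ji, for a pair of boundary degrees of freedom) or zero; this is why the
    strict inequalities are conditioned on [0 < D]. *)
Lemma dL_off_bounds (R : realType) (d N : nat) (S : scheme R d N)
    (U : 'I_N -> state R d) (i j : 'I_N) :
  scheme_axioms S -> (forall k, admissible (U k)) ->
  let D := dL_off S U i j in let c := cvec S i j in
  [/\ 0 <= D, c != 0 -> 0 < D,
      0 <= D + dot (regvel S (U i)) c,
      0 < D -> 0 < Hstar S U i j -> 0 < D + dot (regvel S (U i)) c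
    & 0 <= D - dot (regvel S (U j)) c /\
      (0 < D -> 0 < Hstar S U j i -> 0 < D - dot (regvel S (U j)) c)].
Proof.
move=> hS hU D c; have g0 := grav_gt0 hS.
have hD : lambda_max S (Wstar S U i j) (Wstar S U j i) ((norm2 c)^-1 *: c)
    * norm2 c <= D by rewrite /D /dL_off le_max lexx.
have [c0|c0] := eqVneq c 0.
  have D0 : 0 <= D.
    by move: hD; rewrite c0 /norm2 dotv0 sqrtr0 mulr0.
  by rewrite c0 !dotv0 addr0 subr0.
have [? ? wi ? wj] := viscosity_bound g0 (lambda_max_bound hS)
  (Hstar_ge0 _ _ _ _ : 0 <= (Wstar S U i j).1)
  (Hstar_ge0 _ _ _ _ : 0 <= (Wstar S U j i).1)
  (Hstar_wet S (hU i) (hU j)) c0 hD.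
by split=> //; exact: ltW.
Qed.

(** * Local bounds on the depth *)

Lemma Ubar_depth (R : realType) (d N : nat) (S : scheme R d N)
    (U : 'I_N -> state R d) (i j : 'I_N) : j != i ->
  (Ubar S U i j).1 = 2^-1 * (Hstar S U i j + Hstar S U j i)
    - (2 * dL_off S U i j)^-1
      * (Hstar S U j i * dot (regvel S (U j)) (cvec S i j)
         - Hstar S U i j * dot (regvel S (U i)) (cvec S i j)).
Proof.
move=> ji; rewrite /Ubar /dL (negPf ji) /= /flux !dotZl div1r.
by [].
Qed.

(** Stated with the factor 2 d_ij on the left so as to hold also when d_ij = 0:
    then c_ij = 0, and both sides vanish. *)
Lemma Ubar_depth_viscosity (R : realType) (d N : nat) (S : scheme R d N)
    (U : 'I_N -> state R d) (i j : 'I_N) :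
  scheme_axioms S -> (forall k, admissible (U k)) -> j != i ->
  let D := dL_off S U i j in
  2 * D * (Ubar S U i j).1 =
    Hstar S U i j * (D + dot (regvel S (U i)) (cvec S i j))
    + Hstar S U j i * (D - dot (regvel S (U j)) (cvec S i j)).
Proof.
move=> hS hU ji D; rewrite Ubar_depth// -/D.
have [D0 cD _ _ _] := dL_off_bounds i j hS hU.
have [c0|/cD Dgt0] := eqVneq (cvec S i j) 0.
  by rewrite c0 !dotv0 !mulr0 subr0 mulr0 subr0; field.
by field; rewrite gt_eqF.
Qed.

Lemma Ubar_depth_gt0 (R : realType) (d N : nat) (S : scheme R d N)
    (U : 'I_N -> state R d) (i j : 'I_N) :
  scheme_axioms S -> (forall k, admissible (U k)) -> 0 < (Ubar S U i j).1.
Proof.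
move=> hS hU; have [->|ji] := eqVneq j i.
  by rewrite /Ubar eqxx; exact: hU.
have [D0 cD hi wi [hj wj]] := dL_off_bounds i j hS hU.
have Hi0 := Hstar_ge0 S U i j; have Hj0 := Hstar_ge0 S U j i.
have [c0|/cD Dgt0] := eqVneq (cvec S i j) 0.
  rewrite Ubar_depth// c0 !dotv0 !mulr0 subr0 mulr0 subr0.
  by have [|] := Hstar_wet S (hU i) (hU j); lra.
have D2 : 0 < 2 * dL_off S U i j by rewrite mulr_gt0.
rewrite -(pmulr_rgt0 _ D2) Ubar_depth_viscosity//.
have [H0|H0] := Hstar_wet S (hU i) (hU j).
  by rewrite ltr_wpDr ?mulr_ge0// mulr_gt0// wi.
by rewrite ltr_wpDl ?mulr_ge0// mulr_gt0// wj.
Qed.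

Lemma depth_sum (R : realType) (d : nat) (I : Type) (r : seq I) (P : pred I)
    (F : I -> state R d) :
  (\sum_(k <- r | P k) F k).1 = \sum_(k <- r | P k) (F k).1.
Proof. exact: (big_morph (fun u : state R d => u.1)). Qed.

Lemma BL_depth (R : realType) (d N : nat) (S : scheme R d N)
    (U : 'I_N -> state R d) (i : 'I_N) :
  scheme_axioms S -> (forall k, admissible (U k)) ->
  (BL S U i).1 = \sum_(j in stencil' S i)
    2 * (dL_off S U i j + dot (regvel S (U i)) (cvec S i j))
      * ((U i).1 - Hstar S U i j).
Proof.
move=> hS hU; rewrite /BL depth_sum (big_setD1 i)/= ?stencil_self//.
rewrite Hstar_diag// subrr scaler0 add0r.
apply: eq_bigr => j; rewrite 2!inE => /andP[ji _].
rewrite /dL (negPf ji); transitivity (-2 * (dL_off S U i j + dot (regvel S (U i)) (cvec S i j)) * (Hstar S U i j - (U i).1)) => //.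
ring.
Qed.

(** The reconstruction only lowers the depth, and d_ij + V_i.c_ij >= 0. *)
Lemma BL_depth_ge0 (R : realType) (d N : nat) (S : scheme R d N)
    (U : 'I_N -> state R d) (i : 'I_N) :
  scheme_axioms S -> (forall k, admissible (U k)) -> 0 <= (BL S U i).1.
Proof.
move=> hS hU; rewrite BL_depth//; apply: sumr_ge0 => j _.
have [_ _ hi _ _] := dL_off_bounds i j hS hU.
by rewrite !mulr_ge0// subr_ge0 Hstar_le.
Qed.

Lemma Wbar_depth_gt0 (R : realType) (d N : nat) (S : scheme R d N) (tau : R)
    (U : 'I_N -> state R d) (i j : 'I_N) :
  scheme_axioms S -> 0 < tau -> (forall k, admissible (U k)) ->
  0 < (Wbar S tau U i j).1.
Proof.
move=> hS tau0 hU; apply: ltr_wpDr; last exact: Ubar_depth_gt0.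
by apply: mulr_ge0; [rewrite divr_ge0 ?ltW ?mass_gt0 | exact: BL_depth_ge0].
Qed.

(** Each low-order flux splits into the bar-state contribution, the
    corresponding term of B_i, and -2 H_i V_i.c_ij; the last ones cancel with
    the flux for j = i because the c_ij sum to zero over the stencil.  B_i
    enters all the W_ij with total weight 1. *)
Lemma UL_depth_convex (R : realType) (d N : nat) (S : scheme R d N) (tau : R)
    (U : 'I_N -> state R d) (i : 'I_N) :
  scheme_axioms S -> (forall k, admissible (U k)) ->
  let w j := tau / mass S i * (2 * dL_off S U i j) in
  (UL S tau U i).1 =
    (1 - \sum_(j in stencil' S i) w j) * (Wbar S tau U i i).1
    + \sum_(j in stencil' S i) w j * (Wbar S tau U i j).1.
Proof.
move=> hS hU w.
have c0 : \sum_(j in stencil' S i) dot (regvel S (U i)) (cvec S i j)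
    = - dot (regvel S (U i)) (cvec S i i).
  apply/eqP; rewrite -addr_eq0 addrC -(big_setD1 i (stencil_self hS i))/=.
  by rewrite -dot_sumr cvec_sum// dotv0.
have flux : (\sum_(j in stencil S i) FL S U i j).1 =
    \sum_(j in stencil' S i) (2 * dL_off S U i j * ((Ubar S U i j).1 - (U i).1))
    + (BL S U i).1.
  rewrite depth_sum (big_setD1 i)/= ?stencil_self// BL_depth// Hstar_diag//.
  rewrite -/(stencil' S i).
  set A := \sum_(j in stencil' S i) _.
  have -> : A = \sum_(j in stencil' S i)
     (2 * dL_off S U i j * ((Ubar S U i j).1 - (U i).1)
      + 2 * (dL_off S U i j + dot (regvel S (U i)) (cvec S i j))
          * ((U i).1 - Hstar S U i j)
      - 2 * (U i).1 * dot (regvel S (U i)) (cvec S i j)).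
    apply: eq_bigr => j; rewrite 2!inE => /andP[ji _].
    rewrite /dL (negPf ji) mulrBr Ubar_depth_viscosity//.
    set D := dL_off _ _ _ _; set vj := dot _ _; set vi := dot _ _.
    transitivity (- (vj * Hstar S U j i + vi * Hstar S U i j)
      + D * (Hstar S U j i - Hstar S U i j) - 0) => //.
    ring.
  rewrite !big_split/= sumrN -mulr_sumr c0.
  set vi := dot _ _.
  set B := \sum_(j in stencil' S i) _; set C := \sum_(j in stencil' S i) _.
  transitivity (- (vi * (U i).1 + vi * (U i).1) 
    + dL S U i i * ((U i).1 - (U i).1) - 0 + (B + C - 2 * (U i).1 * - vi)) => //.
  ring.
transitivity ((U i).1 + tau / mass S i * (\sum_(j in stencil S i) FL S U i j).1) => //.
rewrite flux; set B := (BL S U i).1.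
have W j : (Wbar S tau U i j).1 = (Ubar S U i j).1 + tau / mass S i * B by [].
have Uii : (Ubar S U i i).1 = (U i).1 by rewrite /Ubar eqxx.
have sumW : \sum_(j in stencil' S i) w j * (Wbar S tau U i j).1 =
    tau / mass S i * (\sum_(j in stencil' S i)
       2 * dL_off S U i j * ((Ubar S U i j).1 - (U i).1))
    + (\sum_(j in stencil' S i) w j) * (Wbar S tau U i i).1.
  transitivity (\sum_(j in stencil' S i)
      (tau / mass S i * (2 * dL_off S U i j * ((Ubar S U i j).1 - (U i).1))
       + w j * (Wbar S tau U i i).1)); last first.
    by rewrite big_split -mulr_sumr -mulr_suml.
  by apply: eq_bigr => j _; rewrite !W Uii /w; ring.
rewrite sumW W Uii; move: (\sum_(j in _) w j) (\sum_(j in _) _) => x y.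
by clear; ring.
Qed.

(** This is the time-step restriction: the weights sum to 2 tau |d_ii| / m_i. *)
Lemma weight_sum_le1 (R : realType) (d N : nat) (S : scheme R d N) (tau : R)
    (U : 'I_N -> state R d) (i : 'I_N) :
  scheme_axioms S -> 0 < tau -> (forall k, admissible (U k)) ->
  (dL S U i i != 0 -> tau <= mass S i / (2 * `|dL S U i i|)) ->
  \sum_(j in stencil' S i) tau / mass S i * (2 * dL_off S U i j) <= 1.
Proof.
move=> hS tau0 hU; have m0 := mass_gt0 hS i.
rewrite -mulr_sumr -mulr_sumr {1 2}/dL eqxx.
set D := \sum_(j in stencil' S i) _.
have D0 : 0 <= D by apply: sumr_ge0 => j _; have [] := dL_off_bounds i j hS hU.
rewrite normrN ger0_norm// oppr_eq0; move: D0; rewrite le_eqVlt.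
case/predU1P => [<- _|D0]; first by rewrite !mulr0.
rewrite gt_eqF// => /(_ isT); rewrite ler_pdivlMr ?mulr_gt0// => cfl.
by rewrite mulrAC ler_pdivrMr// mul1r.
Qed.

Lemma Hlocmin_le (R : realType) (d N : nat) (S : scheme R d N) (tau : R)
    (U : 'I_N -> state R d) (i j : 'I_N) :
  j \in stencil S i -> Hlocmin S tau U i <= (Wbar S tau U i j).1.
Proof. by move=> ij; rewrite /Hlocmin (bigD1 j)//= ge_min lexx. Qed.

Lemma le_Hlocmax (R : realType) (d N : nat) (S : scheme R d N) (tau : R)
    (U : 'I_N -> state R d) (i j : 'I_N) :
  j \in stencil S i -> (Wbar S tau U i j).1 <= Hlocmax S tau U i.
Proof. by move=> ij; rewrite /Hlocmax (bigD1 j)//= le_max lexx. Qed.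

Lemma Hlocmin_gt0 (R : realType) (d N : nat) (S : scheme R d N) (tau : R)
    (U : 'I_N -> state R d) (i : 'I_N) :
  scheme_axioms S -> 0 < tau -> (forall k, admissible (U k)) ->
  0 < Hlocmin S tau U i.
Proof.
move=> hS tau0 hU.
apply: (big_ind (fun x => 0 < x)) => [|x y x0 y0|j _].
- exact: Wbar_depth_gt0.
- by rewrite lt_min x0.
- exact: Wbar_depth_gt0.
Qed.

Lemma UL_depth_bounds (R : realType) (d N : nat) (S : scheme R d N) (tau : R)
    (U : 'I_N -> state R d) (i : 'I_N) :
  scheme_axioms S -> 0 < tau -> (forall k, admissible (U k)) ->
  (dL S U i i != 0 -> tau <= mass S i / (2 * `|dL S U i i|)) ->
  Hlocmin S tau U i <= (UL S tau U i).1 <= Hlocmax S tau U i.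
Proof.
move=> hS tau0 hU cfl; rewrite UL_depth_convex//.
have sum1 := weight_sum_le1 hS tau0 hU cfl.
set w := fun j => tau / mass S i * (2 * dL_off S U i j) in sum1 *.
have w0 j : 0 <= w j.
  have [D0 _ _ _ _] := dL_off_bounds i j hS hU.
  by rewrite mulr_ge0 ?mulr_ge0// ?invr_ge0 ltW// mass_gt0.
have ii := stencil_self hS i.
have avg (x : R) : x = (1 - \sum_(j in stencil' S i) w j) * x
    + \sum_(j in stencil' S i) w j * x by rewrite -mulr_suml; ring.
apply/andP; split; [rewrite [leLHS]avg | rewrite [leRHS]avg]; apply: lerD;
  do ?[by apply: ler_wpM2l; rewrite ?subr_ge0 ?Hlocmin_le ?le_Hlocmax];
  apply: ler_sum => j; rewrite 2!inE => /andP[_ ij]; apply: (ler_wpM2l (w0 j)).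
- exact: Hlocmin_le.
- exact: le_Hlocmax.
Qed.

(** * Limiting *)

(** Below the lower bound [m], the limiter gives l |P| <= H - m, so the limited
    depth is at least [m]; inside the bounds, the limited depth is between [H]
    and [H + P]; above the upper bound, [P > 0]. *)
Lemma depth_limiter_gt0 (R : realType) (m M H P e l : R) :
  0 < m -> m <= H <= M -> 0 < e -> 0 <= l ->
  l <= (if H + P < m then Num.min (`|m - H| / (`|P| + e)) 1
        else if H + P <= M then 1
        else Num.min (`|M - H| / (`|P| + e)) 1) ->
  0 < H + l * P.
Proof.
move=> m0 /andP[mH HM] e0 l0; have H0 : 0 < H by exact: lt_le_trans mH.
case: ifPn => [low|]; last rewrite -leNgt => mHP.
  have P0 : P < 0 by lra.
  rewrite le_min => /andP[+ _].
  rewrite (ltr0_norm P0) ler0_norm ?subr_le0// ler_pdivlMr; last by lra.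
  have : 0 <= l * e by rewrite mulr_ge0// ltW.
  by lra.
case: ifPn => [_ l1|]; last first.
  by rewrite -ltNge => high _; rewrite ltr_wpDr// mulr_ge0//; lra.
have [P0|P0] := leP 0 P; first by rewrite ltr_wpDr// mulr_ge0.
have : 0 <= (1 - l) * - P by apply: mulr_ge0; lra.
by lra.
Qed.

Lemma limv_bounds (R : realType) (d N : nat) (S : scheme R d N) (tau : R)
    (U : 'I_N -> state R d) (i j : 'I_N) :
  limv S tau U i j = 0 \/ 0 <= limv S tau U i j <= limh S tau U i j.
Proof. by rewrite /limv; case: xgetP => [l _ [[]]|]; [right|left]. Qed.

(** The coefficient of the pair is symmetrized by a minimum, which can only
    decrease it towards 0; the value 0 is kept apart because it is also the
    conventional value when the set defining the velocity limiter is empty, and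
    membership in the interval is not available then. *)
Lemma limcoef_bounds (R : realType) (d N : nat) (S : scheme R d N) (tau : R)
    (U : 'I_N -> state R d) (i j : 'I_N) :
  limcoef S tau U i j = 0 \/ 0 <= limcoef S tau U i j <= limh S tau U i j.
Proof.
rewrite /limcoef; have := limv_bounds S tau U i j.
have : 0 <= limv S tau U j i.
  by case: (limv_bounds S tau U j i) => [->|/andP[]].
move: (limv _ _ _ _ _) (limv _ _ _ _ _) (limh _ _ _ _ _) => b a h b0 [->|/andP[a0 ah]].
  by left; rewrite min_l.
by right; rewrite le_min a0 b0 ge_min ah.
Qed.

(* The restriction tau <= min_i m_i / (2 |d_ii|) is void at those i where
   d_ii = 0 (the quotient is then +oo, not the value 0 of division by zero). *)
Theorem proposition3p13 (R : realType) (d N : nat) (hd : d = 1%N \/ d = 2%N)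
    (S : scheme R d N) (hS : scheme_axioms S)
    (tau : R) (htau : 0 < tau)
    (U : nat -> 'I_N -> state R d) (n : nat)
    (hU : forall i, admissible (U n i))
    (hCFL : forall i, dL S (U n) i i != 0 ->
              tau <= mass S i / (2 * `|dL S (U n) i i|))
    (hstep : forall i, U n.+1 i = limited_update S tau (U n) i) :
  forall i, admissible (U n.+1 i).
Proof.
move=> i; rewrite hstep.
have m0 := Hlocmin_gt0 i hS htau hU.
have HLb := UL_depth_bounds hS htau hU (hCFL i).
have HL0 : 0 < (UL S tau (U n) i).1.
  by case/andP: HLb => + _; exact: lt_le_trans.
have update : (limited_update S tau (U n) i).1 = (UL S tau (U n) i).1
    + \sum_(j in stencil' S i)
        limcoef S tau (U n) i j * lambda S i * (Pcorr S tau (U n) i j).1.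
  by congr (_ + _); rewrite depth_sum.
suff : 0 < (limited_update S tau (U n) i).1 by [].
rewrite update; have [->|[k ki]] := set_0Vmem (stencil' S i).
  by rewrite big_set0 addr0.
have card0 : 0 < #|stencil' S i|%:R :> R.
  by rewrite ltr0n card_gt0; apply/set0Pn; exists k.
have lam0 : 0 < lambda S i by rewrite divr_gt0.
(* lambda_i times the state limited in the single direction j. *)
pose X j := lambda S i
  * ((UL S tau (U n) i).1 + limcoef S tau (U n) i j * (Pcorr S tau (U n) i j).1).
have X0 j : 0 < X j.
  apply: mulr_gt0 => //.
  case: (limcoef_bounds S tau (U n) i j) => [->|l01]; first by rewrite mul0r addr0.
  case/andP: l01; apply: depth_limiter_gt0 => //.
  by rewrite mulr_gt0 ?eps_gt0// (lt_le_trans m0)//; case/andP: HLb; exact: le_trans.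
have avg : \sum_(j in stencil' S i) lambda S i * (UL S tau (U n) i).1
    = (UL S tau (U n) i).1.
  by rewrite sumr_const -mulr_natr /lambda; field; rewrite gt_eqF.
have XE j : X j = lambda S i * (UL S tau (U n) i).1
    + limcoef S tau (U n) i j * lambda S i * (Pcorr S tau (U n) i j).1.
  by rewrite /X; move: (UL _ _ _ _).1 (Pcorr _ _ _ _ _).1 => x y; ring.
rewrite -{1}avg -big_split (eq_bigr X) => [|j _]; last first.
  by rewrite XE.
by rewrite (big_setD1 k)//= ltr_wpDr//; apply: sumr_ge0 => j _; exact: ltW.
Qed.
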